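(* Let $(p_i)_{i\ge1}$ be a fixed sequence in $[0,1]$ (independent of $n$), not identically $1$, and let $k'\ge0$ be the largest integer such that $p_i=1$ for all $i\le k'$. Let $l,m\in\mathbb N$ be fixed and let $\mathcal L,\mathcal M$ be two simplicial complexes of dimension at least $k'+1$ on the vertex sets $[l]$ and $[m]$ respectively. Let $T_{\mathcal L},T_{\mathcal M}$ be the numbers of copies of $\mathcal L$ and $\mathcal M$ in $\mathbf X(n,\mathbf p)$, $\mathbf p=(p_1,\dots,p_{n-1})$, and let $\sigma_{\mathcal L}^2=\mathrm{Var}(T_{\mathcal L})$, $\sigma_{\mathcal M}^2=\mathrm{Var}(T_{\mathcal M})$, assumed positive for all $n\ge\max(l,m)$. Then $$\lim_{n\to\infty}\sigma_{\mathcal L}^{-1}\sigma_{\mathcal M}^{-1}\,\mathrm{Cov}(T_{\mathcal L},T_{\mathcal M})=1.$$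
   Context: $[n]=\{1,\dots,n\}$; $\binom{[n]}{k}$ is the set of $k$-element subsets of $[n]$. Let $H$ be the random hypergraph on $[n]$ in which every singleton is present and every subset of size $k+1\ge2$ is included with probability $p_k$, independently of all others. $\mathbf X(n,\mathbf p)$ is the largest simplicial complex contained in $H$: a nonempty $s\subseteq[n]$ is a simplex iff every nonempty $t\subseteq s$ lies in $H$. A simplex with $k+1$ vertices has dimension $k$; the dimension of a complex is the maximal dimension of its simplices. For a simplicial complex $\mathcal L$ on vertex set $[m]$ (all singletons $\{v\}$, $v\in[m]$, are simplices) let $[\mathcal L]$ be the set of all simplicial complexes on $[m]$ simplicially isomorphic to $\mathcal L$. For $s=\{s_1<\dots<s_m\}\in\binom{[n]}m$ and $\mathcal L'\in[\mathcal L]$ let $\mathcal L'[s]$ be the complex on $s$ in which $\{s_{i_1},\dots,s_{i_r}\}$ is a simplex iff $\{i_1,\dots,i_r\}\in\mathcal L'$. The number of copies of $\mathcal L$ in $\mathbf X(n,\mathbf p)$ is $T_{\mathcal L}=\sum_{s\in\binom{[n]}m}\sum_{\mathcal L'\in[\mathcal L]}\mathbf 1(\mathcal L'[s]\subseteq\mathbf X(n,\mathbf p))$. *)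

(* Defs.v *)
From HB Require Import structures.
From mathcomp Require Import all_boot all_order all_algebra all_fingroup.
From mathcomp Require Import all_classical all_reals all_analysis.

Set Implicit Arguments.
Unset Strict Implicit.
Unset Printing Implicit Defensive.

Import Order.TTheory GRing.Theory Num.Theory.
Import numFieldNormedType.Exports.

(* The vertex set {1, ..., m} is 'I_m = {0, ..., m - 1}; a complex is given by
   the set of its simplices, which are nonempty. *)
Definition simplicial_complex (m : nat) (K : {set {set 'I_m}}) : bool :=
  [&& finset.set0 \notin K,
      [forall v : 'I_m, [set v]%SET \in K] &
      [forall s in K, forall t : {set 'I_m},
         (t != finset.set0) && (t \subset s) ==> (t \in K)]].

Definition complex_dim (m : nat) (K : {set {set 'I_m}}) : nat :=
  \max_(s in K) #|s|.-1.

Definition simplicially_isomorphic (m : nat) (K L : {set {set 'I_m}}) : bool :=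
  [exists f : {perm 'I_m}, [forall s : {set 'I_m},
     (s \in K) == (f @: s \in L)%SET]].

Definition iso_class (m : nat) (L : {set {set 'I_m}}) : {set {set {set 'I_m}}} :=
  [set K : {set {set 'I_m}} |
     simplicial_complex K && simplicially_isomorphic L K]%SET.

(* 0-based position of x in s: the elements s_0 < s_1 < ... of s are those
   with rank 0, 1, ... *)
Definition vertex_rank (n : nat) (s : {set 'I_n}) (x : 'I_n) : nat :=
  #|[set y in s | (y < x)%N]%SET|.

(* {s_i | i in t} *)
Definition subset_at (m n : nat) (s : {set 'I_n}) (t : {set 'I_m}) : {set 'I_n} :=
  [set x in s | [exists i in t, vertex_rank s x == i :> nat]]%SET.

(* K[s], for #|s| = m *)
Definition place (m n : nat) (K : {set {set 'I_m}}) (s : {set 'I_n}) :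
    {set {set 'I_n}} :=
  [set subset_at s t | t in K]%SET.

(* Largest simplicial complex contained in the hypergraph H. *)
Definition complex_of (n : nat) (H : {set {set 'I_n}}) : {set {set 'I_n}} :=
  [set s : {set 'I_n} | (s != finset.set0) &&
    [forall t : {set 'I_n}, (t != finset.set0) && (t \subset s) ==> (t \in H)]]%SET.

Definition copies (m n : nat) (L : {set {set 'I_m}}) (X : {set {set 'I_n}}) : nat :=
  (\sum_(s : {set 'I_n} | #|s| == m) \sum_(K in iso_class L)
     (place K s \subset X))%N.

Local Open Scope classical_set_scope.
Local Open Scope ring_scope.

Definition mutually_independent (R : realType) (d : measure_display)
    (T : measurableType d) (P : probability T R) (I : finType) (D : {set I})
    (E : I -> set T) : Prop :=
  forall A : {set I}, A \subset D ->
    P (\bigcap_(i in [set` A]) E i) = (\prod_(i in A) P (E i))%E.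

(* The empty set is never looked at by complex_of, so nothing is required of
   the event that it belongs to H. *)
Record random_hypergraph (R : realType) (p : nat -> R) (n : nat)
    (d : measure_display) (T : measurableType d) (P : probability T R)
    (H : T -> {set {set 'I_n}}) : Prop := {
  hyp_singleton : forall w (v : 'I_n), [set v]%SET \in H w ;
  hyp_measurable : forall t : {set 'I_n}, (2 <= #|t|)%N ->
    measurable [set w | t \in H w] ;
  hyp_prob : forall t : {set 'I_n}, (2 <= #|t|)%N ->
    P [set w | t \in H w] = (p #|t|.-1)%:E ;
  hyp_indep : mutually_independent P
    [set t : {set 'I_n} | (2 <= #|t|)%N]%SET
    (fun t => [set w | t \in H w])
}.

(* T_L, for the random complex X(n, p) built from the random hypergraph H *)
Definition num_copies (R : realType) (m n : nat) (L : {set {set 'I_m}})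
    (T : Type) (H : T -> {set {set 'I_n}}) : T -> R :=
  fun w => (copies L (complex_of (H w)))%:R.

(* The variance is a finite extended real here, num_copies being bounded. *)
Definition std_dev (R : realType) (d : measure_display) (T : measurableType d)
    (P : probability T R) (X : T -> R) : R :=
  Num.sqrt (fine 'V_P[X]).

(* Main.v *)
(* Let r = k' + 2 be the smallest size of a face whose presence in X(n, p) is
   random, and q = p_(r-1).  The number of copies of a complex L on [l] is, up to
   the factor |Aut L|, the number of injections f : [l] -> [n] with f(L) in
   X(n, p); with w(S) the product of the probabilities of the faces in S, the
   covariance is thus a sum over pairs (f, g) of w(fL u gM) - w(fL) w(gM).  If the
   images of f and g share at most r vertices, this term is exactly
   w(L) w(M) (1/q - 1) times the number of common faces of size r (which is 0 or
   1).  Summed over all (f, g), the number of common faces of size r is, by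
   symmetry under permutations of [n],
     (n^_l |L_r|) (n^_m |M_r|) / 'C(n, r),
   L_r being the set of faces of size r, which makes the main term of the
   covariance a product h_L(n) h_M(n).  The pairs sharing more than r vertices
   contribute a fraction O(1/n) of it.  Hence Cov(T_L, T_M) ~ h_L h_M,
   Var T_L ~ h_L^2 and Var T_M ~ h_M^2. *)
Require Import Defs.
From HB Require Import structures.
From mathcomp Require Import all_boot all_order all_algebra all_fingroup.
From mathcomp Require Import all_classical all_reals all_analysis.
From mathcomp Require Import zify ring.
Set Implicit Arguments.
Unset Strict Implicit.
Unset Printing Implicit Defensive.
Import Order.TTheory GRing.Theory Num.Theory.
Import numFieldNormedType.Exports.

(** * Copies as embeddings *)

Definition image_complex (A B : finType) (f : A -> B) (K : {set {set A}}) :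
    {set {set B}} :=
  [set f @: t | t : {set A} in K]%SET.

Lemma image_complex_comp (A B C : finType) (f : B -> C) (g : A -> B) K :
  image_complex (f \o g) K = image_complex f (image_complex g K).
Proof.
by rewrite /image_complex -imset_comp; apply: eq_imset => t /=; rewrite imset_comp.
Qed.

Lemma eq_image_complex (A B : finType) (f g : A -> B) K :
  f =1 g -> image_complex f K = image_complex g K.
Proof. by move=> fg; apply: eq_imset => t; exact: eq_imset. Qed.

Lemma image_complex_id (A : finType) (K : {set {set A}}) :
  image_complex id K = K.
Proof. by rewrite -[RHS]imset_id; apply: eq_imset => t; exact: imset_id. Qed.

Lemma subset_imsetP (A B : finType) (f : A -> B) (u : {set A}) (t : {set B}) :
  (t \subset f @: u)%SET -> exists2 v : {set A}, v \subset u & t = (f @: v)%SET.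
Proof.
move=> /fintype.subsetP tu; exists (u :&: f @^-1: t)%SET; first exact: subsetIl.
apply/setP => y; apply/idP/imsetP => [ty|[x]].
  by have /imsetP[x xu yx] := tu _ ty; exists x => //; rewrite !inE xu -yx.
by rewrite !inE => /andP[_ fxt] ->.
Qed.

Section SimplicialComplex.
Variables (m : nat) (K : {set {set 'I_m}}).
Hypothesis Kc : simplicial_complex K.

Lemma complex_set0 : finset.set0 \notin K.
Proof. by case/and3P: Kc. Qed.

Lemma complex_set1 v : [set v]%SET \in K.
Proof. by case/and3P: Kc => _ /forallP. Qed.

Lemma complex_down (s t : {set 'I_m}) :
  s \in K -> t != finset.set0 -> t \subset s -> t \in K.
Proof.
case/and3P: Kc => _ _ /forallP/(_ s) + sK t0 ts.
by rewrite sK => /forallP/(_ t); rewrite t0 ts.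
Qed.

(** By downward closure, any [r + 1] vertices of a simplex of top dimension form a face. This will
    supply faces of the smallest random size. *)
Lemma complex_face r : (0 < r <= complex_dim K)%N ->
  exists2 t, t \in K & #|t| = r.+1.
Proof.
case/andP => r0 rd.
(* The maximum over an empty [K] is 0, which [0 < r] excludes. *)
have K0 : (0 < #|K|)%N.
  rewrite lt0n; apply/eqP => /card0_eq K0.
  by move: rd; rewrite /complex_dim big_pred0// leqNgt r0.
have [s sK Es] := eq_bigmax_cond (fun s : {set 'I_m} => #|s|.-1) K0.
move: rd; rewrite /complex_dim Es => rs.
have /card_geqP[e [ue se es]] : (r.+1 <= #|s|)%N by case: #|s| rs r0 => [|?] //; case: r.
have et : #|[set x in e]%SET| = r.+1 by rewrite cardsE -se; exact/card_uniqP.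
exists [set x in e]%SET => //; apply: (complex_down sK).
  by rewrite -card_gt0 et.
by apply/fintype.subsetP => x; rewrite inE => /es.
Qed.

(** The image of a complex is itself closed under nonempty subsets, so the presence of a copy can be
    tested in the hypergraph directly. *)
Lemma image_complexS (n : nat) (f : 'I_m -> 'I_n) (X : {set {set 'I_n}}) :
  (image_complex f K \subset complex_of X) = (image_complex f K \subset X).
Proof.
apply/idP/idP => /fintype.subsetP fX; apply/fintype.subsetP => s sf.
  have := fX _ sf; rewrite inE => /andP[s0 /forallP/(_ s)].
  by rewrite s0 fintype.subxx.
move: (sf) => /imsetP[u uK su]; rewrite inE; apply/andP; split.
  rewrite su imset_eq0; apply: contraNneq complex_set0 => <-; exact: uK.
apply/forallP => t; apply/implyP => /andP[t0]; rewrite su => /subset_imsetP[v vu tv].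
apply: fX; rewrite tv; apply: imset_f; apply: (complex_down uK) vu.
by apply: contraNneq t0 => v0; rewrite tv v0 imset0.
Qed.

Lemma image_complex_perm (s : {perm 'I_m}) : simplicial_complex (image_complex s K).
Proof.
apply/and3P; split.
- apply/imsetP => -[t tK /esym/eqP]; rewrite imset_eq0 => /eqP t0.
  by move: complex_set0; rewrite -t0 tK.
- apply/forallP => v; apply/imsetP; exists [set s^-1%g v]%SET; first exact: complex_set1.
  by rewrite imset_set1 permKV.
- apply/forallP => t; apply/implyP => /imsetP[u uK ->].
  apply/forallP => t'; apply/implyP => /andP[t'0 /subset_imsetP[v vu tv]].
  rewrite tv; apply: imset_f; apply: (complex_down uK) vu.
  by apply: contraNneq t'0 => v0; rewrite tv v0 imset0.
Qed.

Lemma iso_classP (K' : {set {set 'I_m}}) :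
  reflect (exists s : {perm 'I_m}, K' = image_complex s K) (K' \in iso_class K).
Proof.
rewrite inE; apply: (iffP andP) => [[_ /existsP[s /forallP sK]]|[s ->]].
  exists s; apply/setP => t; apply/idP/imsetP => [tK'|[u uK ->]].
    have tE : (s @: (s^-1%g @: t) = t)%SET.
      by rewrite -imset_comp -[RHS]imset_id; apply: eq_imset => x /=; rewrite permKV.
    by exists (s^-1%g @: t)%SET; rewrite ?tE// (eqP (sK _)) tE.
  by rewrite -(eqP (sK _)).
split; first exact: image_complex_perm.
apply/existsP; exists s; apply/forallP => t.
by rewrite /image_complex mem_imset//; apply: imset_inj; exact: perm_inj.
Qed.

End SimplicialComplex.

Definition automorphisms (m : nat) (K : {set {set 'I_m}}) : {set {perm 'I_m}} :=
  [set s : {perm 'I_m} | image_complex s K == K]%SET.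

Lemma card_automorphisms_gt0 m (K : {set {set 'I_m}}) : (0 < #|automorphisms K|)%N.
Proof.
apply/card_gt0P; exists 1%g; rewrite inE; apply/eqP.
by rewrite -[RHS]image_complex_id; apply: eq_image_complex => x; rewrite perm1.
Qed.

(** On [s] the rank is strictly increasing and below [#|s|]: an injection into a set of the same
    size, hence onto. *)
Lemma vertex_rank_surj n (s : {set 'I_n}) (i : 'I_#|s|) :
  exists x, (x \in s) && (vertex_rank s x == i).
Proof.
have rank_lt (x y : 'I_n) : x \in s -> (x < y)%N -> (vertex_rank s x < vertex_rank s y)%N.
  move=> xs xy; apply: proper_card; apply/properP; split.
    by apply/fintype.subsetP => z; rewrite !inE => /andP[-> /=] zx; exact: ltn_trans zx xy.
  by exists x; rewrite !inE ?xs ?xy ?ltnn.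
have rank_inj : {in s &, injective (vertex_rank s)}.
  move=> x y xs ys exy; apply/val_inj => /=; case: (ltngtP x y) => // xy.
    by have := rank_lt _ _ xs xy; rewrite exy ltnn.
  by have := rank_lt _ _ ys xy; rewrite exy ltnn.
have rank_bound x : x \in s -> (vertex_rank s x < #|s|)%N.
  move=> xs; apply: proper_card; apply/properP; split.
    by apply/fintype.subsetP => z; rewrite !inE => /andP[].
  by exists x; rewrite // inE ltnn andbF.
case Es : #|s| i => [|k] i; first by case: i.
pose f x : 'I_k.+1 := inord (vertex_rank s x).
have fE x : x \in s -> f x = vertex_rank s x :> nat.
  by move=> xs; rewrite inordK// -Es rank_bound.
have f_inj : {in s &, injective f}.
  by move=> x y xs ys fxy; apply: rank_inj => //; rewrite -!fE// fxy.
have /setP/(_ i) : (f @: s = [set: 'I_k.+1])%SET.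
  by apply/eqP; rewrite eqEcard finset.subsetT cardsT card_ord card_in_imset// Es /=.
by rewrite inE => /imsetP[x xs ->]; exists x; rewrite xs fE// eqxx.
Qed.

(** The map [e] inverts the rank, listing [s] in increasing order. Placing a complex thus becomes
    taking its image under an injection. *)
Lemma placement n (s : {set 'I_n}) m : #|s| = m ->
  exists e : 'I_m -> 'I_n, [/\ injective e, (e @: [set: 'I_m] = s)%SET &
    forall K : {set {set 'I_m}}, place K s = image_complex e K].
Proof.
move=> <-; have [e eP] := fin_all_exists (@vertex_rank_surj n s).
have e_inj : injective e.
  move=> i j eij; apply/val_inj => /=.
  by have /andP[_ /eqP <-] := eP i; rewrite eij; have /andP[_ /eqP ->] := eP j.
have e_im : (e @: [set: 'I_#|s|] = s)%SET.
  apply/eqP; rewrite eqEcard card_imset// cardsT card_ord leqnn andbT.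
  by apply/fintype.subsetP => _ /imsetP[i _ ->]; have /andP[] := eP i.
exists e; split => // K; apply: eq_imset => t; apply/setP => x.
rewrite inE; apply/andP/imsetP => [[xs /existsP[i /andP[it /eqP xi]]]|[i it ->]].
  have /imsetP[j _ xj] : x \in (e @: [set: 'I_#|s|])%SET by rewrite e_im.
  exists i => //; rewrite xj; congr e.
  by apply/val_inj; rewrite /= -xi xj; have /andP[_ /eqP] := eP j.
have /andP[es /eqP ei] := eP i; split => //; apply/existsP; exists i.
by rewrite it ei eqxx.
Qed.

Definition embeddings (m n : nat) : {set {ffun 'I_m -> 'I_n}} :=
  [set f : {ffun 'I_m -> 'I_n} | injectiveb f]%SET.

Lemma embeddingsP (m n : nat) (f : {ffun 'I_m -> 'I_n}) :
  reflect (injective f) (f \in embeddings m n).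
Proof. by rewrite inE; exact: injectiveP. Qed.

Lemma card_embeddings (m n : nat) : #|embeddings m n| = (n ^_ m)%N.
Proof. by rewrite card_inj_ffuns !card_ord. Qed.

(** Right translation by [s] carries the stabilizer of [K] onto this fiber, as in the
    orbit-stabilizer theorem. *)
Lemma card_perm_image_complex (m : nat) (K : {set {set 'I_m}}) (s : {perm 'I_m}) :
  #|[set u : {perm 'I_m} | image_complex u K == image_complex s K]%SET| =
  #|automorphisms K|.
Proof.
rewrite -(card_imset (pred_of_set (automorphisms K)) (mulIg s)).
apply: eq_card => u; rewrite inE; apply/eqP/imsetP => [uK|[v]].
  exists (u * s^-1)%g; last by rewrite mulgKV.
  rewrite inE; apply/eqP.
  transitivity (image_complex (s^-1)%g (image_complex u K)).
    by rewrite -image_complex_comp; apply: eq_image_complex => x; rewrite permM.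
  rewrite uK -image_complex_comp -[RHS]image_complex_id.
  by apply: eq_image_complex => x /=; rewrite permK.
rewrite inE => /eqP vK ->.
rewrite -[in RHS]vK -image_complex_comp.
by apply: eq_image_complex => x; rewrite permM.
Qed.

Lemma sum_perm_image_complex (m : nat) (K : {set {set 'I_m}})
    (F : {set {set 'I_m}} -> nat) :
  simplicial_complex K ->
  (\sum_(s : {perm 'I_m}) F (image_complex s K) =
   #|automorphisms K| * \sum_(K' in iso_class K) F K')%N.
Proof.
move=> Kc; rewrite (partition_big (fun s : {perm 'I_m} => image_complex s K)
  (mem (iso_class K)))/=; last by move=> s _; apply/(iso_classP Kc); exists s.
rewrite big_distrr/=; apply: eq_bigr => K' /(iso_classP Kc)[s ->].
rewrite (eq_bigr (fun=> F (image_complex s K))); last by move=> u /eqP ->.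
by rewrite sum_nat_const -(card_perm_image_complex K s) cardsE.
Qed.

Lemma embeddings_onto (m n : nat) (e : 'I_m -> 'I_n) : injective e ->
  [set f in embeddings m n | f @: [set: 'I_m] == e @: [set: 'I_m]]%SET =
  [set [ffun i => e (s i)] | s : {perm 'I_m}]%SET.
Proof.
move=> e_inj; apply/setP => f; rewrite inE; apply/andP/imsetP => [[]|[s _ ->]].
  move=> /embeddingsP f_inj /eqP fe.
  have ex i : exists j, f i = e j.
    have /imsetP[j _ ->] : f i \in (e @: [set: 'I_m])%SET by rewrite -fe imset_f ?inE.
    by exists j.
  have [g gP] := fin_all_exists ex.
  have g_inj : injective g by move=> i j gij; apply: f_inj; rewrite !gP gij.
  by exists (perm g_inj) => //; apply/ffunP => i; rewrite ffunE permE.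
split.
  by apply/embeddingsP => i j; rewrite !ffunE => /e_inj/perm_inj.
apply/eqP/setP => x; apply/imsetP/imsetP => -[i _ ->].
  by exists (s i); rewrite ?inE// ffunE.
by exists (s^-1%g i); rewrite ?inE// ffunE permKV.
Qed.

(** Group the embeddings by their image [s]. Those onto [s] are [e] composed with a permutation [u],
    where [e] enumerates [s], and the image of [K] under [u] runs through the isomorphism class,
    meeting each member once per automorphism. *)
Lemma copies_embeddings (m n : nat) (K : {set {set 'I_m}}) (X : {set {set 'I_n}}) :
  simplicial_complex K ->
  (#|automorphisms K| * copies K X =
   \sum_(f in embeddings m n) (image_complex f K \subset X))%N.
Proof.
move=> Kc.
rewrite [RHS](partition_big (fun f : {ffun 'I_m -> 'I_n} => f @: [set: 'I_m])%SET
  (fun s : {set 'I_n} => #|s| == m))/=; last first.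
  by move=> f /embeddingsP f_inj; rewrite card_imset// cardsT card_ord.
rewrite /copies big_distrr/=; apply: eq_bigr => s /eqP/placement[e [e_inj <- eK]].
transitivity (\sum_(u : {perm 'I_m}) (image_complex e (image_complex u K) \subset X : nat))%N.
  rewrite (sum_perm_image_complex (fun K' => image_complex e K' \subset X : nat) Kc).
  by congr (_ * _)%N; apply: eq_bigr => K' _; rewrite eK.
transitivity (\sum_(f in [set f in embeddings m n | f @: [set: 'I_m] == e @: [set: 'I_m]])
   (image_complex f K \subset X : nat))%N%SET; last by apply: eq_bigl => f; rewrite inE.
rewrite embeddings_onto// big_imset/=; last first.
  move=> u v _ _ /ffunP uv; apply/permP => i; apply: e_inj.
  by have := uv i; rewrite !ffunE.
apply: eq_bigr => u _; rewrite -image_complex_comp.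
by rewrite (@eq_image_complex _ _ [ffun i => e (u i)] (e \o u)) // => i; rewrite ffunE.
Qed.

(** * Counting pairs of embeddings *)

(** List [A] followed by its complement, and [B] likewise; the permutation matches equal positions
    of the two lists. *)
Lemma perm_imset (T : finType) (A B : {set T}) : #|A| = #|B| ->
  exists s : {perm T}, (s @: A = B)%SET.
Proof.
move=> AB; pose sq (C : {set T}) := (enum C ++ enum (~: C))%SET.
have sq_mem C x : x \in sq C by rewrite mem_cat !mem_enum inE orbN.
have sq_uniq C : uniq (sq C).
  rewrite cat_uniq !enum_uniq andbT /=; apply/hasPn => x.
  by rewrite !mem_enum inE.
have sq_size C : size (sq C) = #|T| by rewrite size_cat -!cardE cardsC.
pose s x := nth x (sq B) (index x (sq A)).
(* Each list enumerates all of [T], so the index is in range and the default value of [nth] is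
   irrelevant. *)
have sE y x : s x = nth y (sq B) (index x (sq A)).
  by apply: set_nth_default; rewrite sq_size -(sq_size A) index_mem sq_mem.
have s_inj : injective s.
  move=> x y; rewrite (sE x y) /s => /eqP.
  rewrite nth_uniq ?sq_uniq// ?sq_size -?(sq_size A) ?index_mem ?sq_mem// => /eqP.
  exact: index_inj.
exists (perm s_inj); apply/eqP; rewrite eqEcard card_imset ?AB ?leqnn ?andbT;
  last exact: perm_inj.
apply/fintype.subsetP => _ /imsetP[x xA ->]; rewrite permE /s index_cat mem_enum xA nth_cat.
by rewrite -!cardE -AB cardE index_mem mem_enum xA -mem_enum mem_nth//
  -cardE -AB cardE index_mem mem_enum.
Qed.

Definition faces (m : nat) (K : {set {set 'I_m}}) (r : nat) : {set {set 'I_m}} :=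
  [set t in K | #|t| == r]%SET.

Lemma faces_image_complex (m n : nat) (K : {set {set 'I_m}}) r (f : 'I_m -> 'I_n) :
  injective f -> faces (image_complex f K) r = image_complex f (faces K r).
Proof.
move=> f_inj; apply/setP => t; rewrite inE.
apply/andP/imsetP => [[/imsetP[u uK ->]]|[u]].
  by rewrite card_imset// => ur; exists u => //; rewrite inE uK.
by rewrite inE => /andP[uK ur] ->; rewrite card_imset// imset_f.
Qed.

Lemma card_image_complex (m n : nat) (K : {set {set 'I_m}}) (f : 'I_m -> 'I_n) :
  injective f -> #|image_complex f K| = #|K|.
Proof. by move=> f_inj; rewrite card_imset//; exact: imset_inj. Qed.

(* Composing with permutations of [n] shows that the number of embeddings f with
   t in f(K) depends on the size of t only; it is then found by summing over all
   t of size r. *)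
Lemma card_embeddings_through (m n r : nat) (K : {set {set 'I_m}}) (t : {set 'I_n}) :
  #|t| = r ->
  (#|[set f in embeddings m n | t \in image_complex f K]%SET| * 'C(n, r) =
   n ^_ m * #|faces K r|)%N.
Proof.
move=> tr.
have tE (t' : {set 'I_n}) : #|t'| = r ->
    #|[set f in embeddings m n | t' \in image_complex f K]%SET| =
    #|[set f in embeddings m n | t \in image_complex f K]%SET|.
  move=> t'r; have [s st] : exists s : {perm 'I_n}, (s @: t = t')%SET.
    by apply: perm_imset; rewrite tr.
  pose F (f : {ffun 'I_m -> 'I_n}) := [ffun i => s (f i)].
  have F_inj : injective F.
    move=> f g /ffunP fg; apply/ffunP => i; apply: (@perm_inj _ s).
    by have := fg i; rewrite !ffunE.
  have FK f : image_complex (F f) K = image_complex s (image_complex f K).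
    by rewrite -image_complex_comp; apply: eq_image_complex => i; rewrite ffunE.
  rewrite -[RHS](card_imset _ F_inj); apply: eq_card => f.
  apply/idP/imsetP => [tf|[g tg ->]].
    move: tf; rewrite inE => /andP[/embeddingsP f_inj tf].
    have fE : f = F [ffun i => s^-1%g (f i)].
      by apply/ffunP => i; rewrite !ffunE permKV.
    exists [ffun i => s^-1%g (f i)] => //; rewrite inE; apply/andP; split.
      by apply/embeddingsP => i j; rewrite !ffunE => /perm_inj/f_inj.
    move: tf; rewrite {1}fE FK -st mem_imset//; apply: imset_inj; exact: perm_inj.
  rewrite inE in tg; case/andP: tg => /embeddingsP f_inj tf.
  rewrite inE FK -st imset_f// andbT.
  by apply/embeddingsP => i j; rewrite !ffunE => /perm_inj/f_inj.
rewrite -card_embeddings -[n in 'C(n, _)]card_ord -(card_draws _ r) mulnC -!sum_nat_const.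
transitivity (\sum_(t' in [set t' : {set 'I_n} | #|t'| == r]%SET)
    \sum_(f in embeddings m n) (t' \in image_complex f K))%N.
  apply: eq_bigr => t'; rewrite inE => /eqP/tE <-.
  by rewrite -sum1dep_card big_mkcondr/=.
rewrite exchange_big/=; apply: eq_bigr => f /embeddingsP f_inj.
rewrite -(card_image_complex (faces K r) f_inj) -faces_image_complex//.
rewrite -sum1_card big_mkcond [RHS]big_mkcond/=; apply: eq_bigr => t' _.
by rewrite !inE andbC; case: eqP => //= _; case: (_ \in _).
Qed.

Definition common_faces (l m n r : nat) (L : {set {set 'I_l}}) (M : {set {set 'I_m}}) :
    nat :=
  (\sum_(f in embeddings l n) \sum_(g in embeddings m n)
     #|faces (image_complex f L :&: image_complex g M) r|)%N%SET.

Definition overlapping_pairs (l m n r : nat) : nat :=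
  (\sum_(f in embeddings l n) \sum_(g in embeddings m n)
     (r < #|f @: [set: 'I_l] :&: g @: [set: 'I_m]|))%N%SET.

(** Exchange the sums and fix the common face [t]: the pairs through [t] number a product of two
    counts, both given by [card_embeddings_through] and independent of [t]. The binomial is kept as
    a factor to avoid a division in [nat]. *)
Lemma common_facesE (l m n r : nat) (L : {set {set 'I_l}}) (M : {set {set 'I_m}}) :
  (common_faces n r L M * 'C(n, r) =
   (n ^_ l * #|faces L r|) * (n ^_ m * #|faces M r|))%N%SET.
Proof.
rewrite /common_faces; pose c k (K : {set {set 'I_k}}) (t : {set 'I_n}) :=
  #|[set f in embeddings k n | t \in image_complex f K]%SET|.
have -> : (\sum_(f in embeddings l n) \sum_(g in embeddings m n)
     #|faces (image_complex f L :&: image_complex g M) r|)%N%SET =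
     (\sum_(t in [set t : {set 'I_n} | #|t| == r]) c l L t * c m M t)%N%SET.
  transitivity (\sum_(f in embeddings l n) \sum_(g in embeddings m n)
      \sum_(t in [set t : {set 'I_n} | #|t| == r])
        (t \in image_complex f L) * (t \in image_complex g M))%N%SET.
    apply: eq_bigr => f _; apply: eq_bigr => g _.
    rewrite -sum1_card big_mkcond [RHS]big_mkcond/=; apply: eq_bigr => t _.
    by rewrite !inE; do 2 case: (t \in _); case: (#|t| == r).
  under eq_bigr do rewrite exchange_big.
  rewrite exchange_big/=; apply: eq_bigr => t _.
  rewrite /c -!sum1dep_card !big_mkcondr/= big_distrl/=; apply: eq_bigr => f _.
  by rewrite big_distrr.
(* If [n < r] the binomial is 0, and the right side vanishes too: either [l < r] and [L] has no face
   of size [r], or [n < l] and there is no embedding. *)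
have [nr|rn] := ltnP n r.
  rewrite bin_small// muln0; apply/esym/eqP; rewrite !muln_eq0.
  have [lr|lr] := ltnP l r.
    rewrite (_ : #|faces L r| = 0)%N ?eqxx ?orbT//.
    apply: eq_card0 => t; rewrite inE; apply/andP => -[_ /eqP tr].
    by have := max_card (mem t); rewrite tr card_ord leqNgt lr.
  by rewrite ffact_small// (leq_trans nr).
have C0 : (0 < 'C(n, r))%N by rewrite bin_gt0.
apply/eqP; rewrite -(eqn_pmul2r C0); apply/eqP.
rewrite -mulnA big_distrl/= [RHS]mulnC.
rewrite (eq_bigr (fun=> (n ^_ l * #|faces L r|) * (n ^_ m * #|faces M r|)))%N.
  by rewrite sum_nat_const card_draws card_ord.
move=> t; rewrite inE => /eqP tr.
by rewrite -!(card_embeddings_through _ tr) mulnACA.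
Qed.

(** The values on [U] range over [S] and the others are free; the factor [n ^ #|U|] on the left
    avoids a subtraction in the exponent. *)
Lemma card_family_in (m n : nat) (U : {set 'I_m}) (S : {set 'I_n}) :
  (#|[set g : {ffun 'I_m -> 'I_n} | [forall i in U, g i \in S]]%SET| * n ^ #|U| =
   #|S| ^ #|U| * n ^ m)%N.
Proof.
have -> : #|[set g : {ffun 'I_m -> 'I_n} | [forall i in U, g i \in S]]%SET| =
    (\prod_(i : 'I_m) (if i \in U then #|S| else n))%N.
  pose F (i : 'I_m) : pred 'I_n := [pred x | (i \in U) ==> (x \in S)].
  transitivity #|(family F : simpl_pred {ffun 'I_m -> 'I_n})|.
    by apply: eq_card => g; rewrite inE; apply/forallP/familyP.
  rewrite card_family /image_mem foldrE big_map big_enum/=; apply: eq_bigr => i _.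
  case: ifP => iU; first by apply: eq_card => x; rewrite inE /= iU.
  by rewrite -[RHS]card_ord; apply: eq_card => x; rewrite inE /= iU.
have powU (a : nat) : (a ^ #|U| = \prod_(i : 'I_m) (if i \in U then a else 1))%N.
  by rewrite -big_mkcond prod_nat_const.
have -> : (n ^ m = \prod_(i < m) n)%N by rewrite prod_nat_const card_ord.
rewrite !powU; apply: etrans (esym (big_split _ _ _ _ _)) _.
apply: etrans (big_split _ _ _ _ _); apply: eq_bigr => i _.
by case: ifP => _ /=; rewrite ?mul1n ?muln1.
Qed.

(* For f fixed, the set U of the vertices that g sends into the image of f has more
   than r elements; the bound is a union bound over U. *)
Lemma overlapping_pairs_le (l m n r : nat) :
  (overlapping_pairs l m n r * n ^ r.+1 <=
   n ^ l * (2 ^ m * (l ^ m * n ^ m)))%N.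
Proof.
rewrite /overlapping_pairs; case: (posnP n) => [->|n0]; first by rewrite exp0n// muln0.
have card_f (f : {ffun 'I_l -> 'I_n}) : (#|f @: [set: 'I_l]| <= l)%N%SET.
  by rewrite (leq_trans (leq_imset_card _ _))// cardsT card_ord.
have bound (f : {ffun 'I_l -> 'I_n}) : ((\sum_(g in embeddings m n)
     (r < #|f @: [set: 'I_l] :&: g @: [set: 'I_m]|)) * n ^ r.+1 <=
     2 ^ m * (l ^ m * n ^ m))%N%SET.
  set S := (f @: _)%SET.
  pose G (U : {set 'I_m}) := [set g : {ffun 'I_m -> 'I_n} | [forall i in U, g i \in S]]%SET.
  apply: (@leq_trans ((\sum_(U : {set 'I_m} | (r < #|U|)%N) #|G U|) * n ^ r.+1)%N).
    rewrite leq_mul2r; apply/orP; right.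
    under [leqRHS]eq_bigr do rewrite -sum1_card.
    rewrite (exchange_big_dep predT)//= big_mkcond/=; apply: leq_sum => g _.
    case: ifP => // /embeddingsP g_inj; case: ltnP => // Sg.
    have gS : #|g @^-1: S|%SET = #|S :&: g @: [set: 'I_m]|%SET.
      rewrite -(card_imset _ g_inj); apply: eq_card => x; rewrite [RHS]inE.
      apply/imsetP/andP => [[i]|[xS /imsetP[i _ xi]]].
        by rewrite inE => gi ->; rewrite imset_f// inE.
      by exists i => //; rewrite inE -xi.
    rewrite (bigD1 (g @^-1: S)%SET)//= gS Sg inE; apply/forallP => i.
    by rewrite inE implybb.
  rewrite big_distrl/=.
  apply: (@leq_trans (\sum_(U : {set 'I_m}) l ^ m * n ^ m)%N); last first.
    by rewrite sum_nat_const -cardsT -powersetT card_powerset cardsT card_ord.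
  rewrite big_mkcond; apply: leq_sum => U _; case: ifP => // rU.
  apply: (@leq_trans (#|G U| * n ^ #|U|)%N).
    by rewrite leq_mul2l leq_pexp2l ?orbT.
  rewrite card_family_in leq_mul2r; apply/orP; right.
  have Um : (#|U| <= m)%N by rewrite -[leqRHS]card_ord max_card.
  apply: (@leq_trans (l ^ #|U|)%N); first by rewrite leq_exp2r ?card_f// (leq_ltn_trans _ rU).
  (* Raising the exponent from [#|U|] to [m] requires [l > 0]; for [l = 0] the left side is 0, since
     [U] is nonempty. *)
  case: (posnP l) => [->|l0]; last exact: leq_pexp2l.
  by rewrite exp0n// (leq_ltn_trans _ rU).
rewrite big_distrl/= -[(n ^ l)%N]muln1.
apply: (@leq_trans (\sum_(f : {ffun 'I_l -> 'I_n}) (2 ^ m * (l ^ m * n ^ m)))%N).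
  by rewrite big_mkcond; apply: leq_sum => f _; case: ifP.
by rewrite sum_nat_const card_ffun !card_ord muln1.
Qed.

(** Each factor [n - i] with [i < l] is at least half of [n]. *)
Lemma leq_exp_ffact (l n : nat) : (l.*2 <= n)%N -> (n ^ l <= 2 ^ l * n ^_ l)%N.
Proof.
move=> ln; rewrite ffact_prod.
have E (a : nat) : (a ^ l)%N = (\prod_(i < l) a)%N by rewrite prod_nat_const card_ord.
rewrite !E -big_split/=; apply: leq_prod => i _.
have := ltn_ord i; lia.
Qed.

Lemma leq_bin_exp (n r : nat) : ('C(n, r) <= n ^ r)%N.
Proof.
apply: (@leq_trans (n ^_ r)%N).
  by rewrite -bin_ffact leq_pmulr// fact_gt0.
have -> : (n ^ r = \prod_(i < r) n)%N by rewrite prod_nat_const card_ord.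
rewrite ffact_prod.
by apply: leq_prod => i _; rewrite leq_subr.
Qed.

(** The overlapping pairs have order at most [n ^ (l + m - r - 1)], the common faces, if [L] and [M]
    have faces of size [r], order [n ^ (l + m - r)]. In the constant, [2 ^ m * l ^ m] comes from the
    union bound and [2 ^ l * 2 ^ m] from passing from powers to falling factorials. *)
Lemma overlapping_vs_common_faces (l m n r : nat) (L : {set {set 'I_l}})
    (M : {set {set 'I_m}}) :
  (0 < n)%N -> (r <= n)%N -> (l.*2 <= n)%N -> (m.*2 <= n)%N ->
  (overlapping_pairs l m n r * n * (#|faces L r| * #|faces M r|) <=
   (2 ^ m * l ^ m * 2 ^ l * 2 ^ m) * common_faces n r L M)%N.
Proof.
move=> n0 rn ln mn.
have := overlapping_pairs_le l m n r; have := common_facesE n r L M.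
set A := common_faces _ _ _ _; set O := overlapping_pairs _ _ _ _ => AE Ole.
have nr0 : (0 < n ^ r)%N by rewrite expn_gt0 n0.
(* The new factor [n ^ r] completes [n] to [n ^ r.+1] on the left and dominates the binomial on the
   right. *)
rewrite -(leq_pmul2r nr0).
apply: (@leq_trans (2 ^ m * l ^ m * 2 ^ l * 2 ^ m * (A * 'C(n, r)))%N); last first.
  by rewrite -[leqRHS]mulnA leq_mul2l leq_mul2l leq_bin_exp !orbT.
rewrite AE.
apply: (@leq_trans (n ^ l * (2 ^ m * (l ^ m * n ^ m)) * (#|faces L r| * #|faces M r|))%N).
  by rewrite mulnAC -(mulnA O) -expnS leq_mul2r Ole orbT.
have := leq_mul (leq_exp_ffact ln) (leq_exp_ffact mn).
set a := (n ^ l)%N; set b := (n ^ m)%N; set c := (n ^_ l)%N; set e := (n ^_ m)%N.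
move=> /(leq_mul (leqnn (2 ^ m * l ^ m * (#|faces L r| * #|faces M r|))%N)).
by congr (_ <= _)%N; ring.
Qed.

Local Open Scope classical_set_scope.
Local Open Scope ring_scope.

(** * Covariance as a sum over pairs of embeddings *)

Section IndicatorSums.
Context (R : realType) (d : measure_display) (T : measurableType d)
  (P : probability T R).

Lemma Lfun_indic (A : set T) : measurable A -> (\1_A : T -> R) \in Lfun P 1.
Proof.
move=> mA; apply/Lfun1_integrable; apply: integrable_indic => //.
Qed.

(** Both claims go through one induction, because additivity of the expectation requires the partial
    sum to be integrable. *)
Lemma expectation_sum_indic (I : Type) (s : seq I) (c : I -> R) (A : I -> set T) :
  (forall i, measurable (A i)) ->
  (fun w => \sum_(i <- s) c i * \1_(A i) w) \in Lfun P 1 /\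
  expectation P (fun w => \sum_(i <- s) c i * \1_(A i) w) =
    (\sum_(i <- s) c i * fine (P (A i)))%:E.
Proof.
move=> mA; elim: s => [|i s [Ls Es]].
  rewrite (_ : (fun w => _) = cst 0); last by apply/funext => w; rewrite big_nil.
  by rewrite big_nil expectation_cst; split => //; exact: Lfun_cst.
have Li : (c i \o* \1_(A i) : T -> R) \in Lfun P 1.
  by apply: Lfun_scale => //; exact: Lfun_indic.
rewrite (_ : (fun w => _) = (c i \o* \1_(A i)) \+
    (fun w => \sum_(i <- s) c i * \1_(A i) w)); last first.
  by apply/funext => w; rewrite big_cons/= mulrC.
split; first by rewrite rpredD.
rewrite expectationD// Es expectationZl; last exact: Lfun_indic.
rewrite expectation_indic// big_cons EFinD EFinM fineK//.
exact: fin_num_measure.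
Qed.

(** Cov(X, Y) = E[XY] - E[X]E[Y], and the product of two sums of indicators is a sum of indicators
    of intersections, indexed by the list [s] of pairs. *)
Lemma covariance_sum_indic (I J : finType) (D : {set I}) (E : {set J}) (a b : R)
    (A : I -> set T) (B : J -> set T) :
  (forall i, measurable (A i)) -> (forall j, measurable (B j)) ->
  covariance P (fun w => a * \sum_(i in D) \1_(A i) w)
               (fun w => b * \sum_(j in E) \1_(B j) w) =
  (a * b * \sum_(i in D) \sum_(j in E)
     (fine (P (A i `&` B j)) - fine (P (A i)) * fine (P (B j))))%:E.
Proof.
move=> mA mB.
have sumE (K : finType) (F : {set K}) (c : R) (C : K -> set T) (w : T) :
    c * \sum_(k in F) \1_(C k) w = \sum_(k <- enum F) c * \1_(C k) w.
  by rewrite big_enum/= big_distrr.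
pose s := [seq (i, j) | i <- enum D, j <- enum E].
have [LA EA] := expectation_sum_indic (enum D) (fun=> a) mA.
have [LB EB] := expectation_sum_indic (enum E) (fun=> b) mB.
have [LAB EAB] := expectation_sum_indic s (fun=> a * b)
  (A := fun ij => A ij.1 `&` B ij.2) (fun ij => measurableI _ _ (mA _) (mB _)).
rewrite (_ : (fun w => a * _) = (fun w => \sum_(i <- enum D) a * \1_(A i) w));
  last by apply/funext => w; rewrite sumE.
rewrite (_ : (fun w => b * _) = (fun w => \sum_(j <- enum E) b * \1_(B j) w));
  last by apply/funext => w; rewrite sumE.
have AB : (fun w => \sum_(i <- enum D) a * \1_(A i) w) *
    (fun w => \sum_(j <- enum E) b * \1_(B j) w) =
    (fun w => \sum_(ij <- s) a * b * \1_(A ij.1 `&` B ij.2) w) :> (T -> R).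
  apply/funext => w; rewrite [LHS]/GRing.mul/= big_distrlr/= big_allpairs.
  by apply: eq_bigr => i _; apply: eq_bigr => j _; rewrite indicI/= mulrACA.
rewrite covarianceE// AB// EA EB EAB -EFinM -EFinB; congr EFin.
rewrite /s big_allpairs/= big_distrlr/= -sumrB !big_enum/= big_distrr/=.
apply: eq_bigr => i _; rewrite -sumrB big_enum/= big_distrr/=.
by apply: eq_bigr => j _; rewrite mulrACA mulrBr.
Qed.

End IndicatorSums.

(** * Probabilities of sets of faces *)

Section EdgeProbability.
Context (R : realType) (p : nat -> R) (n : nat) (d : measure_display)
  (T : measurableType d) (P : probability T R) (H : T -> {set {set 'I_n}}).
Hypothesis H_random : random_hypergraph p P H.

(** The w(S) of the overview. Singletons are always present and contribute no factor. *)
Definition edge_weight (k : nat) (S : {set {set 'I_k}}) : R :=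
  \prod_(t in S | (2 <= #|t|)%N) p #|t|.-1.

(** Singletons lie in every [H w], so only sets of size at least 2 impose a condition; the empty set
    is excluded because its membership is unspecified. *)
Let edges_bigcap (S : {set {set 'I_n}}) : finset.set0 \notin S ->
  [set w | S \subset H w] =
  \bigcap_(t in [set` [set t in S | (2 <= #|t|)%N]%SET]) [set w | t \in H w].
Proof.
move=> S0; apply/seteqP; split => [w /fintype.subsetP SH t|w wS] /=.
  by rewrite inE => /andP[/SH].
apply/fintype.subsetP => t tS; have [t2|] := leqP 2 #|t|.
  by apply: (wS t); rewrite /= inE tS.
rewrite ltnS leq_eqVlt ltnS leqn0 => /orP[/cards1P[v ->]|].
  exact: hyp_singleton H_random w v.
by rewrite cards_eq0 => /eqP t0; rewrite t0 (negbTE S0) in tS.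
Qed.

Lemma measurable_edges (S : {set {set 'I_n}}) : finset.set0 \notin S ->
  measurable [set w | S \subset H w].
Proof.
move=> S0; rewrite edges_bigcap//; apply: fin_bigcap_measurable; first exact: finite_finset.
by move=> t /=; rewrite inE => /andP[_ t2]; exact: hyp_measurable H_random t t2.
Qed.

Lemma probability_edges (S : {set {set 'I_n}}) : finset.set0 \notin S ->
  P [set w | S \subset H w] = (edge_weight S)%:E.
Proof.
move=> S0; rewrite edges_bigcap// (hyp_indep H_random); last first.
  by apply/fintype.subsetP => t; rewrite !inE => /andP[].
rewrite /edge_weight -prodEFin (eq_bigl (fun t => (t \in S) && (2 <= #|t|)%N)); last first.
  by move=> t; rewrite inE.
by apply: eq_bigr => t /andP[_ t2]; exact: hyp_prob H_random t t2.
Qed.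

Lemma num_copiesE (m : nat) (L : {set {set 'I_m}}) : simplicial_complex L ->
  num_copies R L H = (fun w => (#|automorphisms L|%:R)^-1 *
    \sum_(f in embeddings m n) \1_[set w | image_complex f L \subset H w] w).
Proof.
move=> Lc; apply/funext => w.
have aut0 : #|automorphisms L|%:R != 0 :> R.
  by rewrite pnatr_eq0 -lt0n card_automorphisms_gt0.
rewrite /num_copies; apply: (mulfI aut0); rewrite mulVKf// -natrM copies_embeddings//.
rewrite natr_sum; apply: eq_bigr => f _; rewrite indicE image_complexS//.
by congr (nat_of_bool _)%:R; apply/idP/idP; rewrite inE.
Qed.

(** Two copies are both present exactly when the union of their face sets lies in the hypergraph. *)
Lemma covariance_num_copies (l m : nat) (L : {set {set 'I_l}}) (M : {set {set 'I_m}}) :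
  simplicial_complex L -> simplicial_complex M ->
  covariance P (num_copies R L H) (num_copies R M H) =
  ((#|automorphisms L|%:R)^-1 * (#|automorphisms M|%:R)^-1 *
   \sum_(f in embeddings l n) \sum_(g in embeddings m n)
     (edge_weight (image_complex f L :|: image_complex g M)%SET -
      edge_weight (image_complex f L) * edge_weight (image_complex g M)))%:E.
Proof.
move=> Lc Mc.
have image0 k (K : {set {set 'I_k}}) (f : 'I_k -> 'I_n) : simplicial_complex K ->
    finset.set0 \notin image_complex f K.
  move=> Kc; apply/imsetP => -[t tK /esym/eqP]; rewrite imset_eq0 => /eqP t0.
  by move: (complex_set0 Kc); rewrite -t0 tK.
rewrite !num_copiesE// covariance_sum_indic; last 2 first.
- by move=> f; apply: measurable_edges; exact: image0.
- by move=> f; apply: measurable_edges; exact: image0.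
congr EFin; congr (_ * _); apply: eq_bigr => f _; apply: eq_bigr => g _.
rewrite (_ : _ `&` _ = [set w | (image_complex f L :|: image_complex g M)%SET \subset H w]).
  by rewrite !probability_edges ?image0// inE negb_or !image0.
by apply/seteqP; split => w /=; rewrite finset.subUset => /andP.
Qed.

End EdgeProbability.

(** * Asymptotics of the covariance *)

Section EdgeWeight.
Context (R : realType) (p : nat -> R).
Hypothesis p01 : forall i, (1 <= i)%N -> 0 <= p i <= 1.

Lemma edge_weight_ge0 k (S : {set {set 'I_k}}) : 0 <= edge_weight p S.
Proof.
apply: prodr_ge0 => t /andP[_ t2].
by have /p01/andP[] : (1 <= #|t|.-1)%N by lia.
Qed.

Lemma edge_weight_le1 k (S : {set {set 'I_k}}) : edge_weight p S <= 1.
Proof.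
apply: prodr_ile1 => t /andP[_ t2].
by apply: p01; lia.
Qed.

Lemma edge_weightID k (A B : {set {set 'I_k}}) :
  edge_weight p A = edge_weight p (A :&: B)%SET * edge_weight p (A :\: B)%SET.
Proof.
rewrite /edge_weight !big_mkcondr/=.
by rewrite (big_setID B).
Qed.

(** The weight is multiplicative over disjoint unions: split the union along [A] and [B] along its
    intersection with [A]. The product form remains valid when weights vanish. *)
Lemma edge_weightUI k (A B : {set {set 'I_k}}) :
  edge_weight p (A :|: B)%SET * edge_weight p (A :&: B)%SET =
  edge_weight p A * edge_weight p B.
Proof.
rewrite (edge_weightID (A :|: B)%SET A) (edge_weightID B A).
rewrite (finset.setIidPr (finset.subsetUl A B)) finset.setDUl finset.setDv finset.set0U.
by rewrite [(B :&: A)%SET]finset.setIC mulrAC mulrA.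
Qed.

Lemma edge_weightUl k (A B : {set {set 'I_k}}) :
  edge_weight p (A :|: B)%SET <= edge_weight p A.
Proof.
rewrite (edge_weightID (A :|: B)%SET A) (finset.setIidPr (finset.subsetUl A B)).
by rewrite ler_piMr ?edge_weight_ge0 ?edge_weight_le1.
Qed.

Lemma edge_weight_image m n (f : 'I_m -> 'I_n) (K : {set {set 'I_m}}) :
  injective f -> edge_weight p (image_complex f K) = edge_weight p K.
Proof.
move=> f_inj; rewrite /edge_weight !big_mkcondr/= big_imset/=; last first.
  by move=> s t _ _; exact: imset_inj.
by apply: eq_bigr => t _; rewrite card_imset.
Qed.

(** * The contribution of one pair of embeddings *)

Section LowestRandomSize.
Variable r : nat.
Hypothesis r2 : (2 <= r)%N.
Hypothesis p_ones : forall i, (1 <= i < r.-1)%N -> p i = 1.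

Lemma edge_weight_small k (S : {set {set 'I_k}}) :
  (forall t, t \in S -> (#|t| <= r)%N) ->
  edge_weight p S = p r.-1 ^+ #|faces S r|.
Proof.
move=> Sr; rewrite -prodr_const /edge_weight big_mkcond [RHS]big_mkcond/=.
apply: eq_bigr => t _; rewrite inE; case: (boolP (t \in S)) => //= /Sr tr.
have [t_r|t_r|->] := ltngtP #|t| r; last by rewrite r2.
  case: ifP => // t2; apply: p_ones; move: t2 t_r; case: #|t| => [|c]//=; lia.
by rewrite leqNgt t_r in tr.
Qed.

Lemma edge_weight_gt0_face k (S : {set {set 'I_k}}) t :
  t \in S -> #|t| = r -> 0 < edge_weight p S -> 0 < p r.-1.
Proof.
move=> tS tr; rewrite !lt0r => /andP[+ _].
have /andP[-> _] : 0 <= p r.-1 <= 1 by apply: p01; lia.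
rewrite andbT; apply: contraNneq => p0; rewrite /edge_weight (bigD1 t)/= ?tS ?tr//.
by rewrite p0 mul0r.
Qed.

Hypothesis p_gt0 : 0 < p r.-1.

(** A shared face of size [r] multiplies the joint weight by the inverse of [p r.-1], compared with
    independence; [kappa] is the relative excess. *)
Let kappa : R := (p r.-1)^-1 - 1.

Section Pair.
Variables (l m n : nat) (L : {set {set 'I_l}}) (M : {set {set 'I_m}}).
Variables (f : 'I_l -> 'I_n) (g : 'I_m -> 'I_n).
Hypotheses (f_inj : injective f) (g_inj : injective g).

Let fL := image_complex f L.
Let gM := image_complex g M.

Let common_subset t : t \in (fL :&: gM)%SET ->
  t \subset (f @: [set: 'I_l] :&: g @: [set: 'I_m])%SET.
Proof.
rewrite inE => /andP[/imsetP[u _ ->] /imsetP[v _ uv]].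
by rewrite finset.subsetI imsetS ?finset.subsetT// uv imsetS ?finset.subsetT.
Qed.

(** A common face of size [r] must be the whole intersection of the two images, so their number c is
    0 or 1, and all other common faces are smaller and have probability 1. With q = [p r.-1],
    [edge_weightUI] says that the weight of the union times q^c is w(L) w(M), and q^(-c) - 1 = c
    [kappa] for these two values of c. *)
Lemma pair_covariance : (#|f @: [set: 'I_l] :&: g @: [set: 'I_m]| <= r)%N%SET ->
  edge_weight p (fL :|: gM)%SET - edge_weight p fL * edge_weight p gM =
  edge_weight p L * edge_weight p M * kappa * #|faces (fL :&: gM)%SET r|%:R.
Proof.
move=> small.
have common_le t : t \in (fL :&: gM)%SET -> (#|t| <= r)%N.
  by move=> /common_subset/subset_leq_card/leq_trans; exact.
have faces_le1 : (#|faces (fL :&: gM)%SET r| <= 1)%N.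
  apply/card_le1_eqP => s t; rewrite !finset.in_set -!finset.in_setI.
  move=> /andP[sC /eqP sr] /andP[tC /eqP tr].
  have eqI u : u \in (fL :&: gM)%SET -> #|u| = r ->
      u = (f @: [set: 'I_l] :&: g @: [set: 'I_m])%SET.
    by move=> uC ur; apply/eqP; rewrite eqEcard common_subset// ur.
  by rewrite (eqI s)// (eqI t).
have := edge_weightUI fL gM; rewrite (edge_weight_small common_le).
rewrite !edge_weight_image// => <-.
rewrite /kappa; case: #|faces _ _| faces_le1 => [|[|//]] _.
  by rewrite expr0 mulr1 subrr mulr0.
by rewrite expr1; field; rewrite gt_eqF.
Qed.

(** A crude bound, enough for the rare pairs with large overlap: a difference of numbers in [0, 1]
    is at most 1 in absolute value, and common faces are among the [#|L|] faces of [fL]. *)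
Lemma pair_covariance_bound : p r.-1 <= 1 ->
  `|edge_weight p (fL :|: gM)%SET - edge_weight p fL * edge_weight p gM -
    edge_weight p L * edge_weight p M * kappa * #|faces (fL :&: gM)%SET r|%:R|
  <= 1 + kappa * #|L|%:R.
Proof.
move=> p_le1; have kappa0 : 0 <= kappa by rewrite subr_ge0 invf_ge1.
have w0 := edge_weight_ge0; have w1 := edge_weight_le1.
rewrite (le_trans (ler_normB _ _))// lerD//.
  rewrite ler_norml; apply/andP; split.
    rewrite lerBrDr (le_trans _ (w0 _ _))// addrC subr_le0.
    by rewrite mulr_ile1.
  by rewrite lerBlDr (le_trans (w1 _ _))// lerDl mulr_ge0.
rewrite ger0_norm ?mulr_ge0// -mulrA.
apply: (@le_trans _ _ (kappa * #|faces (fL :&: gM)%SET r|%:R)).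
  by rewrite ler_piMl ?mulr_ge0 ?mulr_ile1.
rewrite ler_wpM2l// ler_nat -(card_image_complex L f_inj).
by apply: subset_leq_card; apply/fintype.subsetP => t; rewrite !inE => /andP[/andP[]].
Qed.

End Pair.

End LowestRandomSize.
End EdgeWeight.

(** * Relative error of the covariance *)

Section CovarianceEstimate.
Context (R : realType) (p : nat -> R) (r : nat).
Hypothesis p01 : forall i, (1 <= i)%N -> 0 <= p i <= 1.
Hypothesis r2 : (2 <= r)%N.
Hypothesis p_ones : forall i, (1 <= i < r.-1)%N -> p i = 1.
Hypothesis p_gt0 : 0 < p r.-1.
Hypothesis p_lt1 : p r.-1 < 1.

Let kappa : R := (p r.-1)^-1 - 1.

(* Chosen so that deviation_scale L n * deviation_scale M n is the main term of
   Cov(T_L, T_M), see deviation_scaleM. *)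
Definition deviation_scale (m : nat) (K : {set {set 'I_m}}) (n : nat) : R :=
  (#|automorphisms K|%:R)^-1 * (edge_weight p K * #|faces K r|%:R * (n ^_ m)%:R) *
  Num.sqrt (kappa / 'C(n, r)%:R).

Let kappa_gt0 : 0 < kappa.
Proof. by rewrite subr_gt0 invf_gt1. Qed.

Lemma deviation_scale_gt0 (m : nat) (K : {set {set 'I_m}}) (n : nat) :
  0 < edge_weight p K -> (0 < #|faces K r|)%N -> (m <= n)%N -> (r <= n)%N ->
  0 < deviation_scale K n.
Proof.
move=> wK fK mn rn; rewrite /deviation_scale.
rewrite mulr_gt0 ?sqrtr_gt0 ?divr_gt0 ?ltr0n ?bin_gt0//.
rewrite mulr_gt0 ?invr_gt0 ?ltr0n ?card_automorphisms_gt0//.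
by rewrite mulr_gt0 ?ltr0n ?ffact_gt0// mulr_gt0 ?ltr0n.
Qed.

(** The two square roots multiply to [kappa / 'C(n, r)], and [common_facesE] absorbs the
    binomial. *)
Lemma deviation_scaleM (l m n : nat) (L : {set {set 'I_l}}) (M : {set {set 'I_m}}) :
  (r <= n)%N ->
  deviation_scale L n * deviation_scale M n =
  (#|automorphisms L|%:R)^-1 * (#|automorphisms M|%:R)^-1 *
  (edge_weight p L * edge_weight p M * kappa *
   (common_faces n r L M)%:R).
Proof.
move=> rn; have C0 : 'C(n, r)%:R != 0 :> R by rewrite pnatr_eq0 -lt0n bin_gt0.
have k0 : 0 <= kappa / 'C(n, r)%:R by rewrite divr_ge0 ?ler0n ?ltW.
rewrite /deviation_scale mulrACA -expr2 sqr_sqrtr//.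
have /(congr1 (fun k : nat => k%:R : R)) := common_facesE n r L M.
set A := common_faces _ _ _ _; rewrite !natrM => AE.
have -> : A%:R = (n ^_ l)%:R * #|faces L r|%:R * ((n ^_ m)%:R * #|faces M r|%:R) /
    'C(n, r)%:R :> R.
  by rewrite -AE mulfK.
have L0 : #|automorphisms L|%:R != 0 :> R by rewrite pnatr_eq0 -lt0n card_automorphisms_gt0.
have M0 : #|automorphisms M|%:R != 0 :> R by rewrite pnatr_eq0 -lt0n card_automorphisms_gt0.
by field; rewrite C0 L0 M0.
Qed.

Variables (l m : nat) (L : {set {set 'I_l}}) (M : {set {set 'I_m}}).
Hypotheses (Lc : simplicial_complex L) (Mc : simplicial_complex M).
Hypotheses (wL : 0 < edge_weight p L) (wM : 0 < edge_weight p M).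
Hypotheses (fL : (0 < #|faces L r|)%N) (fM : (0 < #|faces M r|)%N).

(** Only the overlapping pairs deviate from the main term, each by a bounded amount, and their
    number is O(1/n) times that of the common faces. The constant depends neither on [n] nor on the
    probability space. *)
Lemma covariance_estimate : exists C : R, forall n, (0 < n)%N -> (r <= n)%N ->
  (l.*2 <= n)%N -> (m.*2 <= n)%N ->
  forall (d : measure_display) (T : measurableType d) (P : probability T R)
    (H : T -> {set {set 'I_n}}), random_hypergraph p P H ->
  `|fine (covariance P (num_copies R L H) (num_copies R M H)) /
    (deviation_scale L n * deviation_scale M n) - 1| <= C / n%:R.
Proof.
pose e := edge_weight p L * edge_weight p M * kappa.
have e0 : 0 < e by rewrite !mulr_gt0.
pose D := 1 + kappa * #|L|%:R.
have D0 : 0 <= D by rewrite addr_ge0 ?mulr_ge0// ltW.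
pose K := (2 ^ m * l ^ m * 2 ^ l * 2 ^ m)%N.
(* Here [D] bounds the deviation of one pair, [K] is the constant of [overlapping_vs_common_faces],
   and [e] is the coefficient of the main term. *)
exists (D * K%:R / (e * (#|faces L r| * #|faces M r|)%:R)).
move=> n n0 rn ln mn d T P H HR.
have l_n : (l <= n)%N by rewrite (leq_trans _ ln)// -addnn leq_addr.
have m_n : (m <= n)%N by rewrite (leq_trans _ mn)// -addnn leq_addr.
have := mulr_gt0 (deviation_scale_gt0 wL fL l_n rn) (deviation_scale_gt0 wM fM m_n rn).
have := overlapping_vs_common_faces L M n0 rn ln mn.
rewrite (deviation_scaleM L M rn) (covariance_num_copies HR Lc Mc)/= -/e -/K.
set A := common_faces _ _ _ _; set O := overlapping_pairs _ _ _ _.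
set S := \sum_(f in _) _; set a := _^-1 * _^-1; set F := (#|_| * #|_|)%N => OA aeA.
have a0 : a != 0 by rewrite mulf_neq0// invr_neq0// pnatr_eq0 -lt0n card_automorphisms_gt0.
(* Positivity of the number of common faces is read off from that of the deviation scales. *)
have A0 : 0 < A%:R :> R.
  by rewrite ltr0n lt0n; apply: contraTneq aeA => ->; rewrite !mulr0 ltxx.
have F0 : 0 < F%:R :> R by rewrite ltr0n muln_gt0 fL.
have n0' : 0 < n%:R :> R by rewrite ltr0n.
have SO : `|S - e * A%:R| <= D * O%:R.
  rewrite /S /A /O /common_faces /overlapping_pairs !natr_sum !big_distrr/= -sumrB.
  apply: (le_trans (ler_norm_sum _ _ _)); apply: ler_sum => f /embeddingsP f_inj.
  rewrite !natr_sum !big_distrr/= -sumrB.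
  apply: (le_trans (ler_norm_sum _ _ _)); apply: ler_sum => g /embeddingsP g_inj.
  have [small|large] := leqP.
    by rewrite (pair_covariance r2 p_ones p_gt0 L M f_inj g_inj small) subrr normr0 mulr0.
  by rewrite mulr1 pair_covariance_bound// ltW.
rewrite -mulf_div divff// mul1r.
have -> : S / (e * A%:R) - 1 = (S - e * A%:R) / (e * A%:R).
  by rewrite mulrBl divff// mulf_neq0 ?gt_eqF.
rewrite normrM [`|_^-1|]gtr0_norm ?invr_gt0 ?mulr_gt0//.
rewrite ler_pdivrMr ?mulr_gt0// (le_trans SO)//.
have {}OA : O%:R * n%:R * F%:R <= K%:R * A%:R :> R by rewrite -!natrM ler_nat.
rewrite [leRHS](_ : _ = D * (K%:R * A%:R / (n%:R * F%:R))).
  by rewrite ler_wpM2l// ler_pdivlMr ?mulr_gt0// mulrA.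
by field; rewrite !gt_eqF.
Qed.

End CovarianceEstimate.

(** * Passage to the limit *)

Lemma cvg1_of_estimate (R : realType) (x : nat -> R) (C : R) (N : nat) :
  (forall n, (N <= n)%N -> `|x n - 1| <= C / n%:R) -> x @ \oo --> (1 : R).
Proof.
move=> xC; apply/cvgrPdist_le => e e0.
near=> n; rewrite distrC.
have Nn : (N <= n)%N by near: n; exact: nbhs_infty_ge.
apply: (le_trans (xC n Nn)).
have n0 : (0 < n)%N by near: n; exact: nbhs_infty_gt.
rewrite ler_pdivrMr ?ltr0n// mulrC -ler_pdivrMr//.
by near: n; exact: nbhs_infty_ger.
Unshelve. all: by end_near. Qed.

(** If the weight were 0, every copy would have probability 0, and so would every union of two
    copies; all terms of the variance would vanish. *)
Lemma edge_weight_gt0_of_variance (R : realType) (p : nat -> R) (n m : nat)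
    (p01 : forall i, (1 <= i)%N -> 0 <= p i <= 1) (d : measure_display)
    (T : measurableType d) (P : probability T R) (H : T -> {set {set 'I_n}})
    (K : {set {set 'I_m}}) :
  simplicial_complex K -> random_hypergraph p P H ->
  (0 < 'V_P[num_copies R K H])%E -> 0 < edge_weight p K.
Proof.
move=> Kc HR; rewrite /variance (covariance_num_copies HR Kc Kc) lte_fin => V0.
rewrite lt0r edge_weight_ge0// andbT; apply: contraTneq V0 => K0.
rewrite big1 ?mulr0 ?ltxx// => f /embeddingsP f_inj; rewrite big1// => g _.
rewrite edge_weight_image// K0 mul0r subr0; apply/eqP.
rewrite -[_ == _]andTb eq_le edge_weight_ge0// andbT.
by rewrite (le_trans (edge_weightUl p01 _ _))// edge_weight_image// K0.
Qed.

Theorem theorem5p2 (R : realType) (p : nat -> R)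
  (p01 : forall i, (1 <= i)%N -> 0 <= p i <= 1)
  (p_not_id1 : exists2 i, (1 <= i)%N & p i <> 1)
  (k' : nat)
  (k'_ones : forall i, (1 <= i <= k')%N -> p i = 1)
  (k'_largest : forall k, (forall i, (1 <= i <= k)%N -> p i = 1) -> (k <= k')%N)
  (l m : nat) (L : {set {set 'I_l}}) (M : {set {set 'I_m}})
  (Lcomplex : simplicial_complex L) (Mcomplex : simplicial_complex M)
  (dimL : (k'.+1 <= complex_dim L)%N) (dimM : (k'.+1 <= complex_dim M)%N)
  (d : nat -> measure_display) (T : forall n, measurableType (d n))
  (P : forall n, probability (T n) R)
  (H : forall n, T n -> {set {set 'I_n}})
  (H_random : forall n, random_hypergraph p (P n) (@H n))
  (varL_gt0 : forall n, (maxn l m <= n)%N ->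
     (0 < 'V_(P n)[num_copies R L (@H n)])%E)
  (varM_gt0 : forall n, (maxn l m <= n)%N ->
     (0 < 'V_(P n)[num_copies R M (@H n)])%E) :
  (fun n => (std_dev (P n) (num_copies R L (@H n)))^-1 *
            (std_dev (P n) (num_copies R M (@H n)))^-1 *
            fine (covariance (P n) (num_copies R L (@H n))
                                 (num_copies R M (@H n))))
    @ \oo --> (1 : R).
Proof.
pose r := k'.+2.
have r2 : (2 <= r)%N by [].
have p_lt1 : p r.-1 < 1.
  have /andP[_ p1] : 0 <= p k'.+1 <= 1 by exact: p01.
  rewrite lt_neqAle p1 andbT; apply/eqP => pk.
  (* If [p k'.+1] were 1, then [k'.+1] would contradict the maximality of [k']. *)
  suff : (k'.+1 <= k')%N by rewrite ltnn.
  apply: k'_largest => i /andP[i1]; rewrite leq_eqVlt => /orP[/eqP -> //|ik].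
  by apply: k'_ones; rewrite i1.
have p_ones i : (1 <= i < r.-1)%N -> p i = 1 by move=> ?; exact: k'_ones.
(* The weight does not depend on [n], so positive variance at the single value [maxn l m]
   suffices. *)
have wL := edge_weight_gt0_of_variance p01 Lcomplex (H_random _) (varL_gt0 _ (leqnn _)).
have wM := edge_weight_gt0_of_variance p01 Mcomplex (H_random _) (varM_gt0 _ (leqnn _)).
have [s sL sr] := complex_face Lcomplex (r := k'.+1) dimL.
have [t tM tr] := complex_face Mcomplex (r := k'.+1) dimM.
have p_gt0 : 0 < p r.-1 by apply: (edge_weight_gt0_face p01 _ sL sr wL).
have fL : (0 < #|faces L r|)%N by apply/card_gt0P; exists s; rewrite inE sL sr eqxx.
have fM : (0 < #|faces M r|)%N by apply/card_gt0P; exists t; rewrite inE tM tr eqxx.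
(* Beyond [N] all size conditions of [covariance_estimate] hold, for each of the pairs (L, M), (L,
   L) and (M, M). *)
pose N := (r + l.*2 + m.*2)%N.
have rN : (r <= N)%N := leq_trans (leq_addr _ _) (leq_addr _ _).
have lN : (l.*2 <= N)%N := leq_trans (leq_addl _ _) (leq_addr _ _).
have mN : (m.*2 <= N)%N := leq_addl _ _.
pose rho a b (A : {set {set 'I_a}}) (B : {set {set 'I_b}}) (n : nat) : R :=
  fine (covariance (P n) (num_copies R A (@H n)) (num_copies R B (@H n))) /
  (deviation_scale p r A n * deviation_scale p r B n).
have ratio a b (A : {set {set 'I_a}}) (B : {set {set 'I_b}}) :
    simplicial_complex A -> simplicial_complex B ->
    0 < edge_weight p A -> 0 < edge_weight p B ->
    (0 < #|faces A r|)%N -> (0 < #|faces B r|)%N -> (a.*2 <= N)%N -> (b.*2 <= N)%N ->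
    rho a b A B @ \oo --> (1 : R).
  move=> Ac Bc wA wB fA fB aN bN.
  have [C HC] := covariance_estimate p01 r2 p_ones p_gt0 p_lt1 Ac Bc wA wB fA fB.
  apply: (@cvg1_of_estimate _ _ C N) => n Nn.
  apply: HC (H_random n); first exact: leq_trans (leq_trans rN Nn).
  - exact: leq_trans rN Nn.
  - exact: leq_trans aN Nn.
  - exact: leq_trans bN Nn.
have cLM := ratio _ _ _ _ Lcomplex Mcomplex wL wM fL fM lN mN.
have cLL := ratio _ _ _ _ Lcomplex Lcomplex wL wL fL fL lN lN.
have cMM := ratio _ _ _ _ Mcomplex Mcomplex wM wM fM fM mN mN.
have inv_sqrt (x : nat -> R) : x @ \oo --> (1 : R) ->
    (fun n => (Num.sqrt (x n))^-1) @ \oo --> (1 : R).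
  move=> x1; rewrite -[X in _ --> X]invr1 -[X in X^-1]sqrtr1.
  apply: cvgV; first by rewrite sqrtr1 oner_neq0.
  by apply: continuous_cvg => //; exact: sqrt_continuous.
(* The correlation is rho_LM / sqrt(rho_LL rho_MM), since the deviation scales cancel; it remains to
   verify this identity for large [n]. *)
have cvg1 : (fun n => (Num.sqrt (rho _ _ L L n))^-1 * (Num.sqrt (rho _ _ M M n))^-1 *
    rho _ _ L M n) @ \oo --> (1 * 1 * 1 : R).
  by apply: cvgM cLM; apply: cvgM; exact: inv_sqrt.
rewrite !mulr1 in cvg1; apply: cvg_trans cvg1; apply: near_eq_cvg; near=> n.
have Nn : (N <= n)%N by near: n; exact: nbhs_infty_ge.
have hL : 0 < deviation_scale p r L n.
  apply: deviation_scale_gt0 => //; last exact: leq_trans rN Nn.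
  by rewrite (leq_trans _ Nn)// (leq_trans _ lN)// -addnn leq_addr.
have hM : 0 < deviation_scale p r M n.
  apply: deviation_scale_gt0 => //; last exact: leq_trans rN Nn.
  by rewrite (leq_trans _ Nn)// (leq_trans _ mN)// -addnn leq_addr.
rewrite /rho /std_dev /variance /=.
have sqrtE (v h : R) : 0 < h -> (Num.sqrt (v / (h * h)))^-1 = (Num.sqrt v)^-1 * h.
  move=> h0; rewrite [v / _]mulrC -expr2 sqrtrM ?invr_ge0 ?sqr_ge0//.
  by rewrite sqrtrV ?sqr_ge0// sqrtr_sqr gtr0_norm// invfM invrK mulrC.
(* With the inverse square roots abstracted, the cancellation only requires nonzero deviation
   scales. *)
rewrite !sqrtE//; set x := (Num.sqrt _)^-1; set y := (Num.sqrt _)^-1.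
by field; rewrite !gt_eqF.
Unshelve. all: by end_near. Qed.
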